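(* For every integer $e\ge 0$, with $q=2^{2e+1}$, the graph $\mathrm{VSz}(q)$ is separating.
   Context: Let $q=2^{2e+1}$ and let $\sigma$ be the field automorphism $a\mapsto a^{2^{e+1}}$ of $\mathbb{F}_q$. The Suzuki–Tits ovoid of $\mathrm{PG}(3,q)$ is $\mathcal{O}=\{\langle(0,0,1,0)\rangle\}\cup\{\langle(1,x,y,\,xy+x^{\sigma+2}+y^{\sigma})\rangle : x,y\in\mathbb{F}_q\}$ ($q^2+1$ points). The graph $\mathrm{VSz}(q)$ has vertex set $\mathbb{F}_q^4$, with distinct $u,v$ adjacent if $\langle u-v\rangle\in\mathcal{O}$; it is strongly regular with parameters $(q^4,(q-1)(q^2+1),q-2,q(q-1))$. A graph $\Gamma$ is separating if $\omega(\Gamma)\alpha(\Gamma)<|V(\Gamma)|$, where $\omega$ and $\alpha$ are the maximum clique and coclique sizes.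
   Formalization: The point at infinity of the Suzuki–Tits ovoid is taken as ⟨(0,0,0,1)⟩ instead of the printed ⟨(0,0,1,0)⟩; with the printed point the set is not an ovoid, and for q=2 the graph has ω=α=4, so ωα=16=|V| and it is not separating. *)

(* Defs.v *)
From mathcomp Require Import all_boot all_order all_algebra.

Set Implicit Arguments.
Unset Strict Implicit.
Unset Printing Implicit Defensive.

Import GRing.Theory.

Local Open Scope ring_scope.

(* A simple graph on a finType is a symmetric irreflexive relation. *)

Definition clique (T : finType) (adj : rel T) (A : {set T}) : bool :=
  [forall u in A, forall v in A, (u != v) ==> adj u v].

Definition coclique (T : finType) (adj : rel T) (A : {set T}) : bool :=
  [forall u in A, forall v in A, (u != v) ==> ~~ adj u v].

Definition clique_number (T : finType) (adj : rel T) : nat :=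
  \max_(A : {set T} | clique adj A) #|A|.

Definition coclique_number (T : finType) (adj : rel T) : nat :=
  \max_(A : {set T} | coclique adj A) #|A|.

Definition separating (T : finType) (adj : rel T) : Prop :=
  (clique_number adj * coclique_number adj < #|T|)%N.

Definition vec4 (F : finFieldType) (a b c d : F) : 'rV[F]_4 :=
  \row_(j < 4) [:: a; b; c; d]`_j.

(* When #|F| = 2 ^ (2e+1) this is the Tits automorphism: sigma (sigma a) is
   the Frobenius image a ^+ 2. *)
Definition sigma (F : finFieldType) (e : nat) (a : F) : F := a ^+ (2 ^ e.+1).

(* x^(sigma+2) stands for x^sigma * x^2. *)
Definition ovoid_form (F : finFieldType) (e : nat) (x y : F) : F :=
  x * y + sigma e x * x ^+ 2 + sigma e y.

(* Points of PG(3,q) are the lines <[v]>%VS, v != 0, of F^4. With the affine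
   points written as (1, x, y, z), z = ovoid_form e x y, the point at infinity
   has to be <(0,0,0,1)>. Taking <(0,0,1,0)> instead does not give an ovoid: it
   is collinear with the affine points (1,1,0,1) and (1,1,1,1). *)
Definition suzuki_tits_ovoid (F : finFieldType) (e : nat) :
    pred {vspace 'rV[F]_4} :=
  [pred P | (P == <[vec4 0%R 0%R 0%R 1%R]>%VS)
         || [exists x : F, exists y : F,
               P == <[vec4 1%R x y (ovoid_form e x y)]>%VS]].

Definition VSz (F : finFieldType) (e : nat) : rel 'rV[F]_4 :=
  [rel u v | (u != v) && (<[u - v]>%VS \in suzuki_tits_ovoid e)].

Arguments VSz F e : clear implicits.

Lemma VSz_irreflexive (F : finFieldType) (e : nat) : irreflexive (VSz F e).
Proof. by move=> u; rewrite /VSz /= eqxx. Qed.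

Lemma VSz_symmetric (F : finFieldType) (e : nat) : symmetric (VSz F e).
Proof.
suff lineN (w : 'rV[F]_4) : (<[- w]> = <[w]>)%VS.
  by move=> u v; rewrite /VSz /= eq_sym -(opprB v u) lineN.
by apply/eqP; rewrite eqEsubv -!memvE memvN memv_line -memvN memv_line.
Qed.

(* Main.v *)
(* Let q = #|F|. The ovoid has no three collinear points, so a clique with two
   points u, v lies on the affine line through them: cliques have at most q
   points. Conversely every hyperplane through 0 contains an ovoid point, which
   forces a coclique to meet every affine hyperplane in at most q^2 points; a
   double count over all hyperplanes then shows that cocliques have fewer than
   q^3 points. Hence the product of the two numbers is less than q^4. *)
Require Import Defs.
From mathcomp Require Import all_boot all_order all_algebra all_field.
From mathcomp Require Import ring zify.

Set Implicit Arguments.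
Unset Strict Implicit.
Unset Printing Implicit Defensive.

Import GRing.Theory.

Local Open Scope ring_scope.

(** * Counting points on hyperplanes *)

Section Hyperplanes.
Variables (F : finFieldType) (n : nat).

Definition dot (a v : 'rV[F]_n) : F := \sum_i a 0 i * v 0 i.

Lemma dotC (a v : 'rV[F]_n) : dot a v = dot v a.
Proof. by apply: eq_bigr => i _; rewrite mulrC. Qed.

Lemma dotDr (a u v : 'rV[F]_n) : dot a (u + v) = dot a u + dot a v.
Proof. by rewrite -big_split; apply: eq_bigr => i _; rewrite mxE mulrDr. Qed.

Lemma dotZr (a v : 'rV[F]_n) k : dot a (k *: v) = k * dot a v.
Proof. by rewrite mulr_sumr; apply: eq_bigr => i _; rewrite mxE mulrCA. Qed.

Lemma dotBr (a u v : 'rV[F]_n) : dot a (u - v) = dot a u - dot a v.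
Proof. by rewrite -scaleN1r dotDr dotZr mulN1r. Qed.

Lemma dot_delta (a : 'rV[F]_n) i : dot a (delta_mx 0 i) = a 0 i.
Proof.
rewrite /dot (bigD1 i) //= big1 ?addr0 ?mxE ?eqxx ?mulr1 // => j ji.
by rewrite mxE (negPf ji) andbF mulr0.
Qed.

(** Translating along a coordinate vector on which [a] is nonzero embeds each level set of [dot a]
    into any other, so the [#|F|] level sets have equal size and partition the space. *)
Lemma card_hyperplane (a : 'rV[F]_n) c :
  a != 0 -> (#|[set v | dot a v == c]| * #|F| = #|F| ^ n)%N.
Proof.
move=> /rV0Pn[i ai0].
have fib_le c1 c2 :
    (#|[set v | dot a v == c1]| <= #|[set v | dot a v == c2]|)%N.
  pose f (v : 'rV[F]_n) := v + ((c2 - c1) / a 0 i) *: delta_mx 0 i.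
  rewrite -(card_imset _ (addIr _ : injective f)).
  apply/subset_leq_card/subsetP => _ /imsetP[v + ->].
  by rewrite !inE => /eqP vc; rewrite dotDr dotZr dot_delta divfK // vc subrKC.
have -> : (#|F| ^ n = #|{: 'rV[F]_n}|)%N by rewrite card_mx mul1n.
rewrite -[RHS]sum1_card (partition_big (dot a) predT) //=.
rewrite mulnC -sum_nat_const; apply: eq_bigr => c' _.
by rewrite sum1dep_card; apply/eqP; rewrite eqn_leq !fib_le.
Qed.

End Hyperplanes.

(** * The Tits automorphism in characteristic 2 *)

Section TitsForm.
Variables (e : nat) (F : finFieldType).
Hypothesis hF : #|F| = (2 ^ (2 * e + 1))%N.

Lemma pchar2 : 2%N \in [pchar F].
Proof. by apply: (card_finPcharP (n := (2 * e + 1)%N)). Qed.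

Lemma two_eq0 : 2%:R = 0 :> F.
Proof. exact: pcharf0 pchar2. Qed.

(* Lets ring prove identities modulo 2, given an explicit cofactor c. *)
Lemma eq_mod2 (c x y : F) : x - y = 2%:R * c -> x = y.
Proof. by rewrite two_eq0 mul0r => /eqP; rewrite subr_eq0 => /eqP. Qed.

Lemma sigmaD (x y : F) : sigma e (x + y) = sigma e x + sigma e y.
Proof.
by rewrite /sigma exprDn_pchar // (eq_pnat _ (pcharf_eq pchar2)) pnatX pnat_id.
Qed.

Lemma sigmaM (x y : F) : sigma e (x * y) = sigma e x * sigma e y.
Proof. exact: exprMn. Qed.

Lemma sigmaX (x : F) n : sigma e (x ^+ n) = sigma e x ^+ n.
Proof. exact: exprAC. Qed.

(** The composite exponent is [2 ^ (2 * e + 2)], twice the field order, and raising to the field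
    order is the identity. *)
Lemma sigmaK2 (x : F) : sigma e (sigma e x) = x ^+ 2.
Proof.
rewrite /sigma -exprM -expnD.
have -> : (e.+1 + e.+1 = (2 * e + 1).+1)%N by lia.
by rewrite expnSr exprM -hF expf_card.
Qed.

Lemma sigma_eq0 (x : F) : (sigma e x == 0) = (x == 0).
Proof. by rewrite /sigma expf_eq0 expn_gt0. Qed.

Lemma sigma_inj : injective (sigma e : F -> F).
Proof.
move=> x y xy; apply/eqP; rewrite -subr_eq0 -sigma_eq0.
by rewrite -(inj_eq (addIr (sigma e y))) -sigmaD subrK add0r xy.
Qed.

(** * Symmetries of the ovoid form and the cap property *)

(** The form changes only by an affine function of [x] and [y], so this is an affine symmetry of the
    ovoid; it moves the origin to the point over [(a, b)]. *)
Lemma ovoid_form_translate (a b x y : F) :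
  ovoid_form e (x + a) (y + b + sigma e a * x) =
  ovoid_form e x y + ovoid_form e a b
  + b * x + a * y + a * sigma e a * x.
Proof.
rewrite /ovoid_form !(sigmaD, sigmaM) sigmaK2.
set X := sigma e x; set A := sigma e a.
apply: (@eq_mod2 (A * x ^+ 2 + X * x * a + A * x * a + a ^+ 2 * X)).
by ring.
Qed.

Lemma sigma_ovoid_form (x y : F) :
  sigma e (ovoid_form e x y) =
  sigma e x * sigma e y + x ^+ 2 * sigma e x ^+ 2 + y ^+ 2.
Proof.
rewrite /ovoid_form !sigmaD (sigmaM _ (x ^+ 2)) (sigmaM x y) sigmaX !sigmaK2.
by [].
Qed.

(** The plane z = 0 is tangent at the origin. *)
Lemma ovoid_form_eq0 (x y : F) : ovoid_form e x y = 0 -> x = 0 /\ y = 0.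
Proof.
move=> z0; have := sigma_ovoid_form x y; rewrite z0 => Z0.
have {}Z0 : sigma e x * sigma e y + x ^+ 2 * sigma e x ^+ 2 + y ^+ 2 = 0.
  by rewrite -Z0; apply/eqP; rewrite sigma_eq0.
(* Adding [sigma e x] times the equation z = 0 to its image under [sigma] eliminates [sigma e y]. *)
have : y * (sigma e x * x + y) = 0.
  rewrite -Z0; apply/eqP; rewrite -subr_eq0; apply/eqP.
  rewrite -[RHS](mulr0 (- sigma e x)) -z0 /ovoid_form.
  by apply: (@eq_mod2 (sigma e x * x * y)); ring.
move/eqP; rewrite mulf_eq0 => /orP[/eqP y0 | ].
  move: z0; rewrite y0 /ovoid_form mulr0 add0r /sigma expr0n expn_eq0 /= addr0.
  by move/eqP; rewrite mulf_eq0 !expf_eq0 /= expn_gt0 orbb => /eqP.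
rewrite addrC addr_eq0 (oppr_pchar2 pchar2) => /eqP yE.
have /eqP : sigma e x * x ^+ 2 = 0.
  rewrite -z0 yE /ovoid_form sigmaM sigmaK2.
  by apply: (@eq_mod2 (- sigma e x * x ^+ 2)); ring.
rewrite mulf_eq0 sigma_eq0 expf_eq0 /= orbb => /eqP x0.
by rewrite yE x0 mulr0.
Qed.

(* Says that (x, y, z) |-> (y / z, x / z, 1 / z) preserves the affine part of
   the ovoid, minus the origin. *)
Lemma ovoid_form_inversion (x y : F) (z := ovoid_form e x y) :
  x * y * sigma e z + sigma e y * y ^+ 2 + sigma e x * z ^+ 2
  = z * sigma e z.
Proof.
rewrite /z sigma_ovoid_form /ovoid_form.
set X := sigma e x; set Y := sigma e y.
apply: (@eq_mod2 (x ^+ 3 * X ^+ 2 * y + X * x * y * Y)); ring.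
Qed.

(** Scaling by [t] multiplies the left side of the inversion identity by [t ^+ 2 * sigma e t] but
    the right side by [t * sigma e t]; for z nonzero this forces [t = 1]. *)
Lemma ovoid_form_scale (t x y : F) :
  t != 0 -> ovoid_form e (t * x) (t * y) = t * ovoid_form e x y ->
  t = 1 \/ x = 0 /\ y = 0.
Proof.
move=> t0 tE; case: (eqVneq (ovoid_form e x y) 0) => [/ovoid_form_eq0|z0].
  by right.
left; have := ovoid_form_inversion (t * x) (t * y); rewrite /= tE !sigmaM.
have := ovoid_form_inversion x y.
set z := ovoid_form e x y in z0 *; set T := sigma e t; set Z := sigma e z.
move=> /= H1 H2; rewrite -/Z in H1.
have T0 : T != 0 by rewrite sigma_eq0.
have Z0 : Z != 0 by rewrite sigma_eq0.
apply: (mulIf (mulf_neq0 (mulf_neq0 t0 T0) (mulf_neq0 z0 Z0))).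
transitivity (t * z * (T * Z)); last by ring.
rewrite -H2; transitivity (t ^+ 2 * T * (z * Z)); first by ring.
by rewrite -H1; ring.
Qed.

(** The inverse translation, taking [(x, y)] to the origin. The correction is linear in the
    differences, so collinear points stay proportional. *)
Lemma ovoid_form_relative (x y x' y' : F) (d := x' - x) :
  ovoid_form e d (y' - y - sigma e x * d) =
  ovoid_form e x' y' - ovoid_form e x y
  - (y * d + x * (y' - y - sigma e x * d) + x * sigma e x * d).
Proof.
have := ovoid_form_translate x y d (y' - y - sigma e x * d).
rewrite subrK (_ : _ + y + _ = y'); last by ring.
by move=> ->; ring.
Qed.

(* No three affine points of the ovoid are collinear: a translation moves the
   first one to the origin. *)
Lemma ovoid_form_cap (s x y x' y' x2 y2 : F) :
  s != 0 -> x2 - x = s * (x' - x) -> y2 - y = s * (y' - y) ->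
  ovoid_form e x2 y2 - ovoid_form e x y =
    s * (ovoid_form e x' y' - ovoid_form e x y) ->
  s = 1 \/ x' = x /\ y' = y.
Proof.
move=> s0 xE yE zE.
have := ovoid_form_relative x y x' y'; have := ovoid_form_relative x y x2 y2.
rewrite /= zE xE yE; set dx := x' - x; set z := ovoid_form e x y.
set dy := y' - y - _ => H2 H1.
have dyE : s * (y' - y) - sigma e x * (s * dx) = s * dy by rewrite /dy; ring.
have [||[dx0 dy0]] := @ovoid_form_scale s dx dy s0; [|by left|right].
  by rewrite -dyE H1 H2 dyE; ring.
have xx : x' = x by apply/eqP; rewrite -subr_eq0 -/dx dx0.
split=> //; apply/eqP; rewrite -subr_eq0.
by move: dy0; rewrite /dy dx0 mulr0 subr0 => ->.
Qed.

Lemma sigma_surj (c : F) : exists y, sigma e y = c.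
Proof.
have [g _ gK] := injF_bij sigma_inj.
by exists (g c).
Qed.

(** * Ovoid directions in coordinates, and cliques *)

Lemma row4P (u v : 'rV[F]_4) :
  u 0 0 = v 0 0 -> u 0 1 = v 0 1 -> u 0 2 = v 0 2 -> u 0 3 = v 0 3 -> u = v.
Proof.
move=> h0 h1 h2 h3; apply/rowP => -[[|[|[|[|//]]]] lt4].
- by rewrite (_ : Ordinal _ = 0) //; apply: val_inj.
- by rewrite (_ : Ordinal _ = 1) //; apply: val_inj.
- by rewrite (_ : Ordinal _ = 2) //; apply: val_inj.
- by rewrite (_ : Ordinal _ = 3) //; apply: val_inj.
Qed.

Lemma vec4E (a b c d : F) (v := vec4 a b c d) :
  (v 0 0 = a) * (v 0 1 = b) * (v 0 2 = c) * (v 0 3 = d).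
Proof. by rewrite /v !mxE. Qed.

Lemma ovoid_coord (w : 'rV[F]_4) :
  w != 0 -> <[w]>%VS \in suzuki_tits_ovoid e ->
  (exists2 k, k != 0 & w = vec4 0 0 0 k) \/
  exists k x y, k != 0 /\ w = k *: vec4 1 x y (ovoid_form e x y).
Proof.
move=> w0; rewrite inE => /orP[/eqP wE | /existsP[x /existsP[y /eqP wE]]].
  have /vlineP[k kE] : w \in <[vec4 0%R 0%R 0%R (1%R : F)]>%VS
    by rewrite -wE memv_line.
  left; exists k; first by apply: contraNneq w0 => k0; rewrite kE k0 scale0r.
  by rewrite kE; apply: row4P; rewrite !(vec4E, mxE) /= ?mulr0 ?mulr1.
have /vlineP[k kE] : w \in <[vec4 1%R x y (ovoid_form e x y)]>%VS
  by rewrite -wE memv_line.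
right; exists k, x, y; split=> //.
by apply: contraNneq w0 => k0; rewrite kE k0 scale0r.
Qed.

(** The three directions are collinear points of the ovoid, so the cap property makes them coincide.
    The cases record which of them is the point at infinity. *)
Lemma ovoid_line (a b : 'rV[F]_4) :
  a != 0 -> b != 0 -> a - b != 0 ->
  <[a]>%VS \in suzuki_tits_ovoid e -> <[b]>%VS \in suzuki_tits_ovoid e ->
  <[a - b]>%VS \in suzuki_tits_ovoid e -> exists t, b = t *: a.
Proof.
move=> a0 b0 c0 /(ovoid_coord a0) Oa /(ovoid_coord b0) Ob /(ovoid_coord c0) Oc.
have coordE (v w : 'rV[F]_4) (vw : v = w) :
    [/\ v 0 0 = w 0 0, v 0 1 = w 0 1, v 0 2 = w 0 2 & v 0 3 = w 0 3].
  by rewrite vw.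
case: Oa => [[k k0 aE]|[k [x [y [k0 aE]]]]];
  case: Ob => [[l l0 bE]|[l [x' [y' [l0 bE]]]]].
- exists (l / k); rewrite aE bE; apply: row4P;
    by rewrite !(vec4E, mxE) /= ?mulr0 ?divfK.
(* With exactly one of [a], [b] at infinity, the third direction would be an affine point over the
   same [(x, y)], hence the same point. *)
- case: Oc => [[m m0]|[m [x2 [y2 [m0]]]]]; rewrite aE bE => /coordE[];
    rewrite !mxE /= !mulr1 !sub0r => /eqP.
    by rewrite oppr_eq0 (negPf l0).
  move=> /eqP <- /eqP; rewrite mulNr eqr_opp => /eqP/(mulfI l0) <-.
  move=> /eqP; rewrite mulNr eqr_opp => /eqP/(mulfI l0) <-.
  by rewrite mulNr => /eqP; rewrite -subr_eq0 addrK (negPf k0).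
- case: Oc => [[m m0]|[m [x2 [y2 [m0]]]]]; rewrite aE bE => /coordE[];
    rewrite !mxE /= !mulr1 !subr0 => /eqP.
    by rewrite (negPf k0).
  move=> /eqP <- /(mulfI k0) <- /(mulfI k0) <- /eqP.
  by rewrite -subr_eq0 addrAC subrr sub0r oppr_eq0 (negPf l0).
- suff [xx yy] : x' = x /\ y' = y.
    by exists (l / k); rewrite aE bE xx yy scalerA divfK.
  case: Oc => [[m m0]|[m [x2 [y2 [m0]]]]]; rewrite aE bE => /coordE[];
    rewrite !mxE /= !mulr1.
    move=> /eqP; rewrite subr_eq0 => /eqP kl.
    rewrite -kl => /eqP; rewrite subr_eq0 => /eqP/(mulfI k0) -> /eqP.
    by rewrite subr_eq0 => /eqP/(mulfI k0) ->.
  move=> mE xE yE zE.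
  (* First coordinates give [m = k - l], which turns the dependency into the affine form with ratio
     [s = - l / m]; [s = 1] would give [k = 0]. *)
  have key (u u' u2 : F) : k * u - l * u' = m * u2 ->
      u2 - u = (- l / m) * (u' - u).
    move=> uE; apply: (mulfI m0); rewrite mulrBr -uE mulrA mulrCA divff //.
    by rewrite mulr1 -mE; ring.
  have s0 : - l / m != 0 by rewrite mulf_neq0 ?invr_eq0 ?oppr_eq0.
  case: (ovoid_form_cap s0 (key _ _ _ xE) (key _ _ _ yE) (key _ _ _ zE)) => //.
  move=> /(congr1 (fun t => t * m)); rewrite divfK // mul1r -mE => /eqP.
  by rewrite -subr_eq0 opprB addrA addNr sub0r oppr_eq0 (negPf k0).
Qed.

Lemma VSz_clique_le (C : {set 'rV[F]_4}) :
  clique (VSz F e) C -> (#|C| <= #|F|)%N.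
Proof.
move=> /forall_inP Ccl.
have adj u v : u \in C -> v \in C -> u != v ->
    u - v != 0 /\ <[u - v]>%VS \in suzuki_tits_ovoid e.
  move=> /Ccl/forall_inP/[apply]/implyP/[apply] /andP[uv ?].
  by rewrite subr_eq0.
have [C1|/card_gt1P[u [v [uC vC uv]]]] := leqP #|C| 1.
  by apply: leq_trans C1 _; apply/card_gt0P; exists 0.
have CS : C \subset [set u + t *: (v - u) | t in F].
  apply/subsetP => w wC; apply/imsetP.
  have [->|wu] := eqVneq w u; first by exists 0; rewrite ?scale0r ?addr0.
  have [->|wv] := eqVneq w v; first by exists 1; rewrite ?scale1r ?subrKC.
  have [|vu0 vuO] := adj v u vC uC; first by rewrite eq_sym.
  have [wu0 wuO] := adj w u wC uC wu.
  have [|vw0 vwO] := adj v w vC wC; first by rewrite eq_sym.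
  (* All three differences are ovoid directions, so [ovoid_line] puts [w] on the line through [u]
     and [v]. *)
  have vwE : v - w = (v - u) - (w - u) by rewrite opprB addrA subrK.
  rewrite vwE in vw0 vwO.
  have [t tE] := ovoid_line vu0 wu0 vw0 vuO wuO vwO.
  by exists t => //; rewrite -tE subrKC.
by rewrite (leq_trans (subset_leq_card CS)) // leq_imset_card.
Qed.

(** * Hyperplanes and cocliques *)

Lemma ovoid_meets_hyperplane (a : 'rV[F]_4) :
  exists w : 'rV[F]_4,
    [/\ w != 0, dot a w = 0 & <[w]>%VS \in suzuki_tits_ovoid e].
Proof.
have dotE (b c d k : F) :
    dot a (vec4 b c d k) = a 0 0 * b + a 0 1 * c + a 0 2 * d + a 0 3 * k.
  rewrite /dot !big_ord_recl big_ord0 addr0 !addrA !mxE /=.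
  by do 3 ?congr (_ + _); congr (a 0 _ * _); apply: val_inj.
case: (eqVneq (a 0 3) 0) => [a3|a3].
  exists (vec4 0 0 0 1); split; last by rewrite inE eqxx.
    by apply/eqP => /matrixP/(_ 0 3)/eqP; rewrite !mxE oner_eq0.
  by rewrite dotE a3; ring.
(* This [x] cancels the terms linear in [y]; what remains prescribes [sigma e y], which surjectivity
   solves. *)
pose x := - (a 0 2 / a 0 3).
have [y yE] :=
  sigma_surj (- (sigma e x * x ^+ 2 + (a 0 0 + a 0 1 * x) / a 0 3)).
exists (vec4 1 x y (ovoid_form e x y)); split.
- by apply/eqP => /matrixP/(_ 0 0)/eqP; rewrite !mxE oner_eq0.
- rewrite dotE /ovoid_form yE.
  have -> : a 0 2 = - (x * a 0 3) by rewrite /x mulNr divfK // opprK.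
  by field.
- rewrite inE; apply/orP; right; apply/existsP; exists x.
  by apply/existsP; exists y.
Qed.

Lemma vline_scale (k : F) (w : 'rV[F]_4) : k != 0 -> (<[k *: w]> = <[w]>)%VS.
Proof.
move=> k0; apply/eqP; rewrite eqEsubv -!memvE memvZ ?memv_line //=.
by rewrite -{1}[w](scalerK k0) memvZ ?memv_line.
Qed.

(* The translates of a coclique along an ovoid direction w are disjoint, and
   those along some w in the hyperplane a.w = 0 preserve the slices. *)
Lemma coclique_slice_le (S : {set 'rV[F]_4}) (a : 'rV[F]_4) c :
  coclique (VSz F e) S -> a != 0 ->
  (#|[set v in S | dot a v == c]| <= #|F| ^ 2)%N.
Proof.
move=> /forall_inP Sco a0.
have [w [w0 aw wO]] := ovoid_meets_hyperplane a.
have q_gt0 : (0 < #|F|)%N by apply/card_gt0P; exists 0.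
set Sc := [set v in S | _].
pose f (p : 'rV[F]_4 * F) := p.1 + p.2 *: w.
have f_inj : {in setX Sc [set: F] &, injective f}.
  move=> [s t] [s' t']; rewrite !inE !andbT /f /=.
  move=> /andP[sS _] /andP[s'S _] fE.
  have sE : s - s' = (t' - t) *: w.
    by rewrite scalerBl; apply/eqP; rewrite subr_eq addrC addrA -fE addrK.
  (* Otherwise [s - s'] is a nonzero multiple of [w], making two points of the coclique adjacent. *)
  have ss : s = s'.
    apply/eqP; apply: contraT => ss'.
    have tt : t' - t != 0.
      by apply: contraNneq ss' => tt; rewrite -subr_eq0 sE tt scale0r.
    have /forall_inP/(_ _ s'S)/implyP/(_ ss') := Sco _ sS.
    by rewrite /VSz /= ss' sE vline_scale ?wO.
  congr pair => //; move/eqP: sE; rewrite ss subrr eq_sym scaler_eq0 (negPf w0).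
  by rewrite orbF subr_eq0 => /eqP.
have : (#|f @: setX Sc [set: F]| <= #|[set v | dot a v == c]|)%N.
  apply/subset_leq_card/subsetP => _ /imsetP[[s t] + ->].
  by rewrite !inE !andbT /f /= => /andP[_ ?];
    rewrite dotDr dotZr aw mulr0 addr0.
rewrite card_in_imset // cardsX cardsT -(leq_pmul2r q_gt0) card_hyperplane //.
by rewrite -mulnA mulnn -[4%N]/(2 + 2)%N expnD leq_pmul2r // expn_gt0 q_gt0.
Qed.

(* Fix s in S and count the pairs (a, v) with v in S and a.(v - s) = 0 in two
   ways. Summing over v gives q^4 + (|S| - 1) q^3; summing over a and bounding
   the slices by q^2 gives at most |S| + (q^4 - 1) q^2. If |S| = q^3 this says
   q^2 (q - 1)^2 <= 0. *)
Lemma VSz_coclique_lt (S : {set 'rV[F]_4}) :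
  coclique (VSz F e) S -> (#|S| < #|F| ^ 3)%N.
Proof.
move=> Sco; have q_gt1 : (1 < #|F|)%N := finNzRing_gt1 F.
have [->|[s sS]] := set_0Vmem S; first by rewrite cards0 expn_gt0 ltnW.
pose P (a v : 'rV[F]_4) := dot a (v - s) == 0.
have hyp v : v != s -> #|[set a | P a v]| = (#|F| ^ 3)%N.
  rewrite -subr_eq0 => vs; apply/eqP.
  rewrite -(eqn_pmul2r (ltnW q_gt1)) -expnSr -(card_hyperplane 0 vs).
  apply/eqP; congr (_ * _)%N.
  by apply: eq_card => a; rewrite !inE /P dotC.
have card_sum (T : finType) (A : {set T}) (Q : pred T) :
    (\sum_(v in A) Q v = #|[set v in A | Q v]|)%N.
  by rewrite -sum1dep_card big_mkcondr; apply: eq_bigr => v _; case: (Q v).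
have : (\sum_(v in S) \sum_(a : 'rV[F]_4) P a v =
        \sum_(a : 'rV[F]_4) \sum_(v in S) P a v)%N.
  exact: exchange_big.
rewrite (bigD1 s) //= (eq_bigr (fun=> 1%N)) => [|a _]; last first.
  by rewrite /P dotBr subrr eqxx.
rewrite sum1_card card_mx mul1n.
rewrite (eq_bigr (fun=> (#|F| ^ 3)%N)) => [|v /andP[_ vs]]; last first.
  rewrite -(hyp v vs) -sum1dep_card [RHS]big_mkcond.
  by apply: eq_bigr => a _; case: (P a v).
(* [a = 0] is split off: it defines no hyperplane, and its slice is only bounded by [#|S|]. *)
rewrite sum_nat_const [in RHS](bigD1 0) //= card_sum.
have -> : #|[pred v in S | v != s]| = #|S|.-1.
  by rewrite (cardsD1 s S) sS /=; apply: eq_card => v; rewrite !inE andbC.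
have S_gt0 : (0 < #|S|)%N by apply/card_gt0P; exists s.
have le1 : (#|[set v in S | P 0%R v]| <= #|S|)%N.
  by apply/subset_leq_card/subsetP => v; rewrite inE => /andP[].
have le2 : (\sum_(a : 'rV[F]_4 | a != 0%R) \sum_(v in S) P a v
            <= (#|F| ^ 4).-1 * #|F| ^ 2)%N.
  have -> : (#|F| ^ 4).-1 = #|[pred a : 'rV[F]_4 | a != 0%R]|.
    have := cardC1 (0 : 'rV[F]_4); rewrite card_mx mul1n => <-.
    by apply: eq_card => a; rewrite !inE.
  rewrite -sum_nat_const; apply: leq_sum => a a0; rewrite card_sum.
  rewrite (_ : [set v in S | P a v] = [set v in S | dot a v == dot a s]).
    exact: coclique_slice_le.
  by apply/setP => v; rewrite !inE /P dotBr subr_eq0.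
move: (\sum_(a : 'rV[F]_4 | _) _)%N le2 => X le2.
move: #|[set v in S | P 0%R v]| le1 => Y le1 E.
have {E} : (#|F| ^ 4 + #|S|.-1 * #|F| ^ 3 <= #|S| + (#|F| ^ 4).-1 * #|F| ^ 2)%N.
  by rewrite E leq_add.
move: S_gt0 q_gt1; rewrite ltnNge !expnS expn0 muln1.
(* The left side of [le] grows faster in [m] than the right, so [m = q^3] is the extreme case of
   [ge]. *)
move: #|S| #|F| => m q m0 q1 le; apply/negP => ge.
nia.
Qed.

End TitsForm.

Theorem theorem3p13 (e : nat) (F : finFieldType)
  (hF : #|F| = (2 ^ (2 * e + 1))%N) : separating (VSz F e).
Proof.
have q_gt1 : (1 < #|F|)%N := finNzRing_gt1 F.
have cl : (clique_number (VSz F e) <= #|F|)%N.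
  by apply/bigmax_leqP => C; apply: VSz_clique_le.
have co : (coclique_number (VSz F e) < #|F| ^ 3)%N.
  (* A maximum is bounded by a non-strict inequality, hence the passage to [q^3 - 1]. *)
  rewrite /coclique_number -[X in (_ < X)%N]prednK ?expn_gt0 ?(ltnW q_gt1) //.
  apply/bigmax_leqP => S /(VSz_coclique_lt hF) Slt.
  by rewrite -ltnS prednK ?expn_gt0 ?(ltnW q_gt1).
rewrite /separating card_mx mul1n (expnS _ 3).
apply: leq_ltn_trans (_ : (#|F| * coclique_number (VSz F e) < _)%N).
  by rewrite leq_mul2r cl orbT.
by rewrite ltn_pmul2l ?(ltnW q_gt1).
Qed.
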